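(* Let $n\geq 5$ be an integer and let $E(W_n)$ be the eccentricity matrix of the wheel graph $W_n$ on $n$ vertices. Then $E(W_n)$ is invertible if and only if $n\not\equiv 1\pmod 3$.
   Context: For a simple connected graph $G$ with vertices $v_1,\dots,v_n$, let $d(v_i,v_j)$ be the length of a shortest path between $v_i$ and $v_j$, and let $e(v_i)=\max\{d(v_i,v_j):1\le j\le n\}$ be the eccentricity of $v_i$. The eccentricity matrix $E(G)$ is the $n\times n$ real matrix with $(E(G))_{ij}=d(v_i,v_j)$ if $d(v_i,v_j)=\min\{e(v_i),e(v_j)\}$, and $(E(G))_{ij}=0$ otherwise. For $n\ge 4$, the wheel graph $W_n$ is the graph on $n$ vertices consisting of a cycle of length $n-1$ together with one further vertex (the hub) adjacent to every vertex of the cycle. The vertices are labelled so that $v_1$ is the hub and $v_2,\dots,v_n$ are the cycle vertices in cyclic order. *)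

(* Defs.v *)
From mathcomp Require Import all_boot all_order all_algebra.
From mathcomp Require Import reals.
Set Implicit Arguments.
Unset Strict Implicit.
Unset Printing Implicit Defensive.
Import GRing.Theory.
Local Open Scope ring_scope.

(* A simple graph on a finite vertex type T is given by its adjacency relation *)
(* e : rel T, symmetric and irreflexive.                                       *)

Definition walk (T : finType) (e : rel T) (x y : T) (k : nat) : bool :=
  [exists p : k.-tuple T, path e x p && (last x p == y)].

(* The least k such that there is a walk of length k from x to y. The search   *)
(* is bounded by #|T|, which is the (junk) value when y is unreachable from x. *)
Definition dist (T : finType) (e : rel T) (x y : T) : nat :=
  find (walk e x y) (iota 0 #|T|).

Definition ecc (T : finType) (e : rel T) (x : T) : nat :=
  (\max_(y : T) dist e x y)%N.

Definition ecc_mx (R : realType) (n : nat) (e : rel 'I_n) : 'M[R]_n :=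
  \matrix_(i, j) if dist e i j == minn (ecc e i) (ecc e j)
                 then (dist e i j)%:R else 0.

Definition cycle_adj (m a b : nat) : bool :=
  (b == a.+1 %% m)%N || (a == b.+1 %% m)%N.

(* Vertex 0 is the hub; vertices 1, ..., n - 1 are the cycle vertices in       *)
(* cyclic order. This is the wheel graph for n >= 4.                           *)
Definition wheel (n : nat) : rel 'I_n := fun i j =>
  match val i, val j with
  | 0, 0 => false
  | 0, _.+1 => true
  | _.+1, 0 => true
  | a.+1, b.+1 => cycle_adj n.-1 a b
  end%N.

Lemma walk_dist (T : finType) (e : rel T) (x y : T) :
  connect e x y -> walk e x y (dist e x y).
Proof.
move=> /connectP[p0 e_p0 ->]; case: (shortenP e_p0) => p e_p Up _.
have ltp : (size p < #|T|)%N by have := max_card (mem (x :: p)); rewrite (card_uniqP Up).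
have wp : has (walk e x (last x p)) (iota 0 #|T|).
  apply/hasP; exists (size p); first by rewrite mem_iota.
  by apply/existsP; exists (in_tuple p); rewrite e_p eqxx.
have ltf := wp; rewrite has_find size_iota in ltf.
by have := nth_find 0%N wp; rewrite nth_iota.
Qed.

Lemma dist_min (T : finType) (e : rel T) (x : T) (p : seq T) :
  path e x p -> (dist e x (last x p) <= size p)%N.
Proof.
move=> e_p; rewrite leqNgt; apply/negP => ltp.
have ltT : (size p < #|T|)%N.
  by apply: leq_trans ltp _; rewrite -[leqRHS](size_iota 0) find_size.
have := before_find 0%N ltp; rewrite nth_iota // add0n => /negbT/negP; apply.
by apply/existsP; exists (in_tuple p); rewrite e_p eqxx.
Qed.

Lemma wheel_sym (n : nat) : symmetric (@wheel n).
Proof.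
by move=> [[|a] ?] [[|b] ?] //; rewrite /wheel /= /cycle_adj orbC.
Qed.

Lemma wheel_irr (n : nat) : (4 <= n)%N -> irreflexive (@wheel n).
Proof.
move=> n4 [[|a] lta] //=; rewrite /wheel /= /cycle_adj orbb.
case: n n4 lta => [|m] //= n4; rewrite ltnS leq_eqVlt => /orP[/eqP am|lta].
  by move: n4; rewrite -am modnn; case: (a).
by rewrite modn_small // eqn_leq ltnn andbF.
Qed.

Lemma wheel_connected (n : nat) (i j : 'I_n) : connect (@wheel n) i j.
Proof.
case: n i j => [[] //|n] i j.
have c0 (k : 'I_n.+1) : connect (@wheel n.+1) ord0 k.
  by case: k => [[|a] ltk]; [apply: eq_connect0; apply: val_inj | apply: connect1].
by apply: connect_trans (c0 j); rewrite (sym_connect_sym (@wheel_sym _)).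
Qed.

(* Main.v *)
Require Import Defs.
From mathcomp Require Import all_boot all_order all_algebra.
From mathcomp Require Import reals.
From mathcomp Require Import zify ring lra.
Import GRing.Theory Num.Theory.
Local Open Scope ring_scope.

Arguments ordS {n} i.
Arguments ord_pred {n} i.

(* Up to the hub coordinate [x0], a vector of the kernel of the eccentricity
   matrix is a function [g] on the cycle Z/m, m = n - 1. The hub equation says
   that [g] has sum 0, and the cycle equations then say that
   [g (i - 1) + g i + g (i + 1)] is the constant [x0 / 2]. Summing over the cycle
   gives [x0 = 0], so [g] has period 3 as well as period m. If 3 does not divide
   m then [g] is constant, hence 0; otherwise [1, -1, 0, 1, -1, 0, ...] is a
   nonzero element of the kernel. *)

Lemma dist_wheel (n : nat) (i j : 'I_n) :
  dist (@wheel n) i j = if i == j then 0%N else if wheel i j then 1%N else 2%N.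
Proof.
have := @walk_dist _ _ _ _ (wheel_connected i j).
have dist_le p : path (@wheel n) i p -> last i p = j ->
    (dist (@wheel n) i j <= size p)%N by move=> e_p <-; apply: dist_min.
case: eqP => [ij _|/eqP neq_ij]; first by apply/eqP; rewrite -leqn0 (dist_le [::]).
case: ifPn => [w_ij|nw_ij].
  have := dist_le [:: j]; rewrite /= w_ij => /(_ isT erefl).
  case: (dist _ _ _) => [_|[|//]//] /existsP[p].
  by rewrite (tuple0 p) /= (negPf neq_ij).
have le2 : (dist (@wheel n) i j <= 2)%N.
  have n_gt0 : (0 < n)%N := leq_ltn_trans (leq0n i) (ltn_ord i).
  (* The walk goes through the hub. If [i] or [j] is the hub itself, the two vertices are equal or
     adjacent, which is already excluded. *)
  apply: (dist_le [:: Ordinal n_gt0; j]) => //=.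
  by case: i j neq_ij nw_ij {dist_le} => [[|a] lt_a] [[|b] lt_b].
case: (dist _ _ _) le2 => [|[|[|//]//]] _ /existsP[p].
  by rewrite (tuple0 p) /= (negPf neq_ij).
case: p => [[|z [|//]] //= _]; rewrite andbT => /andP[w_iz /eqP z_j].
by rewrite -z_j w_iz in nw_ij.
Qed.

Section Rim.
Variable p : nat.
Implicit Types i j : 'I_p.+1.

(** Puts rim adjacency in terms of the cyclic shift on ['I_p.+1], so that wrap-around is handled by
    [ordS] and [ord_pred]. *)
Lemma wheel_rim i j :
  wheel (lift ord0 i) (lift ord0 j) = (i == ordS j) || (i == ord_pred j).
Proof.
rewrite [RHS]orbC -(inj_eq (@ordS_inj _) i) ord_predK [_ == j]eq_sym.
by rewrite -!val_eqE.
Qed.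

Lemma val_iter_ordS k i : iter k ordS i = ((i + k) %% p.+1)%N :> nat.
Proof.
elim: k => [|k IHk] /=; first by rewrite addn0 modn_small.
by rewrite IHk -addn1 modnDml addn1 addnS.
Qed.

Lemma iter_ordS_card i : iter p.+1 ordS i = i.
Proof. by apply: ord_inj; rewrite val_iter_ordS modnDr modn_small. Qed.

Lemma iter_ordS_neq k i : (0 < k < p.+1)%N -> (iter k ordS i == i) = false.
Proof.
move=> k_bd; apply/eqP => /(congr1 val); rewrite /= val_iter_ordS => eq_i.
have: (i + k = i + 0 %[mod p.+1])%N by rewrite addn0 [RHS]modn_small.
by move/eqP; rewrite eqn_modDl mod0n modn_small; lia.
Qed.

Lemma ecc_hub : ecc (@wheel p.+2) ord0 = 1%N.
Proof.
apply/eqP; rewrite eqn_leq; apply/andP; split.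
  by apply/bigmax_leqP => -[[|b] lt_b] _; rewrite dist_wheel -val_eqE.
apply: leq_trans (leq_bigmax (lift ord0 ord0)).
by rewrite dist_wheel -val_eqE.
Qed.

(** The vertex two steps further along the rim is a witness: on a cycle of length at least 4, shifts
    by 1, 2 and 3 have no fixed point, so it is neither [i] nor a neighbour of [i]. *)
Lemma ecc_rim i : (3 <= p)%N -> ecc (@wheel p.+2) (lift ord0 i) = 2.
Proof.
move=> p_ge3; apply/eqP; rewrite eqn_leq; apply/andP; split.
  by apply/bigmax_leqP => j _; rewrite dist_wheel; do 2?case: ifP.
apply: leq_trans (leq_bigmax (lift ord0 (ordS (ordS i)))).
rewrite dist_wheel (inj_eq lift_inj) wheel_rim ordSK.
have := iter_ordS_neq 2 i; have := iter_ordS_neq 1 i; have := iter_ordS_neq 3 i.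
rewrite /= ![_ == i]eq_sym => -> ; last by lia.
by move=> ->; [move=> -> //; lia | lia].
Qed.

Variable R : realType.

Lemma ecc_mx_hub_hub : ecc_mx R (@wheel p.+2) ord0 ord0 = 0.
Proof. by rewrite mxE dist_wheel eqxx; case: ifP. Qed.

Lemma ecc_mx_hub_rim i : (3 <= p)%N ->
  ecc_mx R (@wheel p.+2) ord0 (lift ord0 i) = 1.
Proof. by move=> p_ge3; rewrite mxE ecc_hub ecc_rim // dist_wheel. Qed.

Lemma ecc_mx_rim_hub i : (3 <= p)%N ->
  ecc_mx R (@wheel p.+2) (lift ord0 i) ord0 = 1.
Proof. by move=> p_ge3; rewrite mxE ecc_hub ecc_rim // dist_wheel. Qed.

(** The rim block is 2(J - I - A), with J the all-ones matrix and A the adjacency matrix of the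
    cycle: only distances equal to 2 survive. As [j], its successor and its predecessor are
    distinct, at most one indicator is 1. *)
Lemma ecc_mx_rim_rim i j : (3 <= p)%N ->
  ecc_mx R (@wheel p.+2) (lift ord0 i) (lift ord0 j) =
  2 - 2 * ((i == j)%:R + (i == ordS j)%:R + (i == ord_pred j)%:R).
Proof.
move=> p_ge3; rewrite mxE !ecc_rim // dist_wheel (inj_eq lift_inj) wheel_rim.
have Sj : (ordS j == j) = false by apply: (iter_ordS_neq 1); lia.
have Pj : (ord_pred j == j) = false.
  by rewrite -(inj_eq (@ordS_inj _)) ord_predK eq_sym.
have PSj : (ordS j == ord_pred j) = false.
  by rewrite -(inj_eq (@ordS_inj _)) ord_predK; apply: (iter_ordS_neq 2); lia.
case: (eqVneq i j) => [->|_]; first by rewrite ![j == _]eq_sym Sj Pj /=; ring.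
case: (eqVneq i (ordS j)) => [->|_]; first by rewrite PSj /=; ring.
by case: (i == _) => /=; ring.
Qed.

Variable v : 'rV[R]_p.+2.
Let g i := v 0 (lift ord0 i).

Lemma mul_ecc_mx_hub : (3 <= p)%N ->
  (v *m ecc_mx R (@wheel p.+2)) 0 ord0 = \sum_i g i.
Proof.
move=> p_ge3; rewrite mxE big_ord_recl ecc_mx_hub_hub mulr0 add0r.
by apply: eq_bigr => i _; rewrite ecc_mx_rim_hub // mulr1.
Qed.

Lemma mul_ecc_mx_rim j : (3 <= p)%N ->
  (v *m ecc_mx R (@wheel p.+2)) 0 (lift ord0 j) =
  v 0 ord0 + 2 * (\sum_i g i - (g j + g (ordS j) + g (ord_pred j))).
Proof.
move=> p_ge3; rewrite mxE big_ord_recl ecc_mx_hub_rim // mulr1; congr (_ + _).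
have sum_delta k : \sum_i g i * (i == k)%:R = g k.
  rewrite (bigD1 k) //= eqxx mulr1 big1 ?addr0 // => i /negPf->.
  by rewrite mulr0.
rewrite -[g j]sum_delta -[g (ordS j)]sum_delta -[g (ord_pred j)]sum_delta.
rewrite -!big_split -sumrB mulr_sumr.
by apply: eq_bigr => i _; rewrite ecc_mx_rim_rim //= /g; ring.
Qed.

End Rim.

Lemma sum_ordS (p : nat) (V : nmodType) (g : 'I_p.+1 -> V) :
  \sum_i g (ordS i) = \sum_i g i.
Proof. by rewrite [RHS](reindex_inj (@ordS_inj _)). Qed.

(** Consecutive relations differ by [g (i + 3) - g i], which gives period 3; with period [p.+1]
    prime to 3, [g] is constant, and then 3 [g i] = 0. *)
Lemma period3_eq0 (p : nat) (R : realType) (g : 'I_p.+1 -> R) :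
  ~~ (3 %| p.+1)%N -> (forall i, g i + g (ordS i) + g (ordS (ordS i)) = 0) ->
  forall i, g i = 0.
Proof.
move=> n3m g3.
have per i : g (ordS (ordS (ordS i))) = g i.
  by have := g3 i; have := g3 (ordS i); lra.
have perq q i : g (iter (q * 3) ordS i) = g i.
  by elim: q => // q IHq; rewrite mulSn iterD /= per.
have gS i : g (ordS i) = g i.
  have := divn_eq p.+1 3; have := ltn_pmod p.+1 (isT : 0 < 3)%N.
  move: n3m; rewrite /dvdn; set q := (p.+1 %/ 3)%N.
  case: (p.+1 %% 3)%N => [|[|[|]]] //= _ _ def_m.
    (* Remainder 1: a single step followed by [q] triple steps is a full turn. For remainder 2 the
       same argument gives period 2, and periods 2 and 3 give period 1. *)
    rewrite -(perq q) -iterSr.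
    have -> : (q * 3).+1 = p.+1 by lia.
    by rewrite iter_ordS_card.
  have gSS k : g (ordS (ordS k)) = g k.
    rewrite -(perq q) -!iterSr.
    have -> : (q * 3).+2 = p.+1 by lia.
    by rewrite iter_ordS_card.
  by rewrite -(gSS (ordS i)) per.
by move=> i; have := g3 i; rewrite !gS; lra.
Qed.

Theorem theorem3p5 (R : realType) (n : nat) (n_ge5 : (5 <= n)%N) :
  (ecc_mx R (@wheel n) \in unitmx) <-> (n <> 1 %[mod 3])%N.
Proof.
case: n n_ge5 => [|[|p]] //; rewrite !ltnS => p_ge3.
have -> : (p.+2 <> 1 %[mod 3])%N <-> ~~ (3 %| p.+1)%N by lia.
split=> [Eunit|n3m].
  apply/negP => m3.
  pose h k : R := if (k %% 3 == 0)%N then 1 else if (k %% 3 == 1)%N then -1 else 0.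
  pose v : 'rV[R]_p.+2 := \row_j (if unlift ord0 j is Some i then h i else 0).
  have v_hub : v 0 ord0 = 0 by rewrite mxE unlift_none.
  have v_rim i : v 0 (lift ord0 i) = h i by rewrite mxE liftK.
  (* Wrap-around is harmless because 3 divides [p.+1]: reduction modulo [p.+1] preserves residues
     modulo 3. *)
  have hS (i : 'I_p.+1) : h (ordS i) = h i.+1 by rewrite /h /= modn_dvdm.
  have hSS (i : 'I_p.+1) : h (ordS (ordS i)) = h i.+2.
    by rewrite /h /= modn_dvdm // -addn1 -modnDml modn_dvdm // modnDml addn1.
  have h3 k : h k + h k.+1 + h k.+2 = 0.
    have: [|| (k %% 3 == 0), (k %% 3 == 1) | (k %% 3 == 2)]%N by lia.
    rewrite /h -(addn2 k) -(addn1 k) -(modnDml k 1) -(modnDml k 2).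
    by case/or3P => /eqP-> /=; ring.
  (* Summing [h3] over the whole cycle counts each value of [h] three times. *)
  have sum_h : \sum_(i < p.+1) h i = 0.
    have: \sum_(i < p.+1) (h i + h (ordS i) + h (ordS (ordS i))) = 0.
      by apply: big1 => i _; rewrite hS hSS h3.
    rewrite !big_split /= (sum_ordS _ _ (fun i => h (ordS i))).
    by rewrite (sum_ordS _ _ (fun i : 'I_p.+1 => h i)); lra.
  have vE : v *m ecc_mx R (@wheel p.+2) = 0.
    apply/rowP => j; rewrite [RHS]mxE; case: (unliftP ord0 j) => [k|] ->.
      rewrite mul_ecc_mx_rim // v_hub (eq_bigr _ (fun i _ => v_rim i)) sum_h.
      rewrite !v_rim; have -> : k = ordS (ord_pred k) by rewrite ord_predK.
      by rewrite ordSK hSS hS; have := h3 (ord_pred k); lra.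
    by rewrite mul_ecc_mx_hub // (eq_bigr _ (fun i _ => v_rim i)).
  have v0 : v = 0 by rewrite -(mulmxK Eunit v) vE mul0mx.
  have := v_rim ord0; rewrite v0 mxE /h /=; lra.
rewrite -row_free_unit; apply: inj_row_free => v vE.
pose g i := v 0 (lift ord0 i).
have sum_g : \sum_i g i = 0 by rewrite -mul_ecc_mx_hub // vE mxE.
have g3 i : g i + g (ordS i) + g (ordS (ordS i)) = v 0 ord0 / 2.
  (* The equation is taken at the middle vertex, so that its predecessor is [i]. *)
  have := mul_ecc_mx_rim _ _ v (ordS i) p_ge3.
  by rewrite vE mxE ordSK -/(g _) sum_g /g; lra.
have v_hub : v 0 ord0 = 0.
  have: \sum_i (g i + g (ordS i) + g (ordS (ordS i))) = 0.
    by rewrite !big_split /= (sum_ordS _ _ (g \o @ordS _)) (sum_ordS _ _ g) sum_g !addr0.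
  rewrite (eq_bigr _ (fun i _ => g3 i)) sumr_const card_ord => /eqP.
  by rewrite mulrn_eq0 /= => /eqP; lra.
have g0 : forall i, g i = 0.
  by apply: period3_eq0 n3m _ => i; rewrite g3 v_hub mul0r.
apply/rowP => j; rewrite [RHS]mxE; case: (unliftP ord0 j) => [k|] -> //.
exact: g0.
Qed.
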